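(* Let $n\ge 2$ and $Q_n=\langle a,b\mid a^{2n}=e,\ a^n=b^2,\ ab=ba^{-1}\rangle$ be the dicyclic group of order $4n$. Then $\delta(\mathcal{G}(Q_n))=3$. Moreover, for every $0\le i\le n-1$, both $E[a^ib,\{e,a^n,a^{n+i}b\}]$ and $E[a^{n+i}b,\{e,a^n,a^ib\}]$ are minimum disconnecting sets of $\mathcal{G}(Q_n)$.
   Context: The power graph $\mathcal{G}(G)$ of a group $G$ has vertex set $G$, distinct $u,v$ adjacent iff one is a positive integer power of the other; $\delta$ denotes minimum degree. $E[x,B]$ is the set of edges with one end $x$ and the other in $B$. A disconnecting set is a set of edges whose removal increases the number of components; a minimum disconnecting set is one of least cardinality. *)

(* Defs.v *)
From mathcomp Require Import all_boot all_fingroup.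
From mathcomp Require Import boolp.

Set Implicit Arguments.
Unset Strict Implicit.
Unset Printing Implicit Defensive.

Local Open Scope group_scope.

(* A finite simple graph on T is its adjacency relation, a symmetric
   irreflexive e : rel T; an edge is the two-element set of its ends. *)
Section Graphs.

Variables (T : finType) (e : rel T).

Definition edges : {set {set T}} :=
  [set [set p.1; p.2] | p in [set p : T * T | e p.1 p.2]].

Definition degree (x : T) : nat := #|[set y | e x y]|.

(* Degrees are at most #|T|, so for nonempty T the default value #|T| does not
   affect the minimum. *)
Definition min_degree : nat := \big[minn/#|T|]_(x : T) degree x.

Definition edges_between (x : T) (B : {set T}) : {set {set T}} :=
  [set f in edges | [exists y in B, f == [set x; y]]].

Definition delete_edges (F : {set {set T}}) : rel T :=
  [rel x y | e x y && ([set x; y] \notin F)].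

Definition disconnecting (F : {set {set T}}) : bool :=
  (F \subset edges) && (n_comp e T < n_comp (delete_edges F) T)%N.

Definition minimum_disconnecting (F : {set {set T}}) : Prop :=
  disconnecting F /\
  forall F' : {set {set T}}, disconnecting F' -> (#|F| <= #|F'|)%N.

End Graphs.

Definition is_pos_power (gT : finGroupType) (u v : gT) : Prop :=
  exists2 m : nat, (0 < m)%N & v = u ^+ m.

Definition power_graph (gT : finGroupType) : rel gT :=
  [rel u v | (u != v) && `[< is_pos_power u v \/ is_pos_power v u >] ].

Arguments power_graph gT : clear implicits.

Lemma power_graph_sym (gT : finGroupType) : symmetric (power_graph gT).
Proof.
move=> u v; rewrite /power_graph /= [u == v]eq_sym; congr (_ && _).
by apply: asbool_equiv_eq; split=> -[]; [right | left | right | left].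
Qed.

Lemma power_graph_irr (gT : finGroupType) : irreflexive (power_graph gT).
Proof. by move=> u; rewrite /power_graph /= eqxx. Qed.

(* gT is the group presented by < a, b | a^(2n) = 1, a^n = b^2, ab = ba^-1 >,
   with a, b : gT the images of the two generators. The relations bound the
   order of the presented group by 4n, so the largest finite quotient, which is
   what \isog Grp describes, is the presented group itself. The Grp notation
   binds its generators, hence only fixes gT up to isomorphism; the remaining
   clauses say that a and b are generators satisfying the relations, which by
   finiteness makes the induced map from the presented group onto gT an
   isomorphism. *)
Definition dicyclic (n : nat) (gT : finGroupType) (a b : gT) : Prop :=
  [/\ [set: gT] \isog Grp (x : y :
        (x ^+ (2 * n)%N, x ^+ n = y ^+ 2, x * y = y * x^-1)),
      <<[set a; b]>> = [set: gT],
      a ^+ (2 * n)%N = 1,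
      a ^+ n = b ^+ 2
    & a * b = b * a^-1].

(* Main.v *)
(* The identity is adjacent to every vertex of a power graph. In a graph with
   such a vertex u, let F be a disconnecting set and S the set of vertices not
   joined to u once F is deleted. Each of the s >= 1 vertices of S sends to the
   complement of S at least one edge (to u), and at least d + 1 - s edges when d
   is the minimum degree; as s * max(1, d + 1 - s) >= d, F has at least d
   elements, and the edges at a vertex of minimum degree form a minimum
   disconnecting set. In the dicyclic group the vertices of degree 3 are the
   a^j b, with neighbours 1, a^n and a^(n+j) b; every power of a has three
   neighbours among the powers of a. *)
Require Import Defs.
From mathcomp Require Import all_boot all_fingroup ssralg zmodp cyclic boolp.

Set Implicit Arguments.
Unset Strict Implicit.
Unset Printing Implicit Defensive.

Local Open Scope group_scope.

(** * Minimum degree and components *)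

Lemma min_degree_le (T : finType) (e : rel T) (x : T) :
  (min_degree e <= degree e x)%N.
Proof.
rewrite /min_degree; have: x \in index_enum T by exact: mem_index_enum.
elim: (index_enum T) => // y s IHs; rewrite big_cons inE.
by case/predU1P=> [->|/IHs]; [apply: geq_minl | apply/leq_trans/geq_minr].
Qed.

(** The vertex [x0] bounds the default value: [d <= degree e x0 <= #|T|]. *)
Lemma min_degree_ge (T : finType) (e : rel T) (d : nat) (x0 : T) :
  (forall x, d <= degree e x)%N -> (d <= min_degree e)%N.
Proof.
move=> le_d; rewrite /min_degree.
apply: (big_ind (fun m => d <= m)%N) => [|m k lem lek|x _]; last exact: le_d.
  exact: leq_trans (le_d x0) (max_card _).
by rewrite leq_min lem.
Qed.

Lemma n_comp_gt1P (T : finType) (e : rel T) : connect_sym e ->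
  reflect (exists x y, ~~ connect e x y) (1 < n_comp e T)%N.
Proof.
move=> symE; apply: (iffP card_gt1P) => [[x [y]]|[x [y nxy]]].
  rewrite !inE !andbT => -[/eqP rx /eqP ry nxy]; exists x, y.
  by rewrite -(root_connect symE) rx ry.
exists (root e x), (root e y); split; try by rewrite inE roots_root.
by rewrite root_connect.
Qed.

Lemma n_comp_universal (T : finType) (e : rel T) (u : T) : symmetric e ->
  (forall y, y != u -> e u y) -> n_comp e T = 1%N.
Proof.
move=> symE univ; rewrite -(n_comp_connect (sym_connect_sym symE) u).
apply: eq_n_comp_r => y; apply/esym; case: (eqVneq y u) => [->|/univ euy].
  exact: connect0.
exact: connect1.
Qed.

Lemma delete_edges_sym (T : finType) (e : rel T) (F : {set {set T}}) :
  symmetric e -> symmetric (delete_edges e F).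
Proof. by move=> symE x y; rewrite /delete_edges /= symE setUC. Qed.

(** * Edge boundaries and the lower bound for disconnecting sets *)

Lemma card_boundary (T : finType) (e : rel T) (S : {set T}) :
  #|[set p | [&& p.1 \in S, p.2 \notin S & e p.1 p.2]]|
    = (\sum_(s in S) #|[set y | e s y] :\: S|)%N.
Proof.
under eq_bigr do rewrite -sum1_card.
rewrite pair_big_dep -sum1_card; apply: eq_bigl => -[x y].
by rewrite !inE.
Qed.

Lemma boundary_ge (T : finType) (e : rel T) (u : T) (S : {set T}) :
    symmetric e -> irreflexive e -> (forall y, y != u -> e u y) ->
    u \notin S -> S != set0 ->
  (min_degree e <= #|[set p | [&& p.1 \in S, p.2 \notin S & e p.1 p.2]]|)%N.
Proof.
move=> symE irrE univ uS; rewrite -card_gt0 => S_gt0.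
set d := min_degree e.
have bound s : s \in S -> (maxn 1 (d.+1 - #|S|) <= #|[set y | e s y] :\: S|)%N.
  move=> sS; rewrite geq_max; apply/andP; split.
    rewrite card_gt0; apply/set0Pn; exists u; rewrite !inE uS symE univ //.
    by apply: contraNneq uS => <-.
  have := min_degree_le e s.
  rewrite -/d /degree -(cardsID S [set y | e s y]) leq_subLR => led.
  (* [s] lies in [S] without being its own neighbour, so at most [#|S| - 1] of its neighbours are in
     [S]. *)
  suff: (#|[set y | e s y] :&: S| < #|S|)%N.
    by rewrite -(ltn_add2r #|[set y | e s y] :\: S|); apply: leq_ltn_trans.
  apply/proper_card/properP; split; first exact: subsetIr.
  by exists s; rewrite // !inE irrE.
rewrite card_boundary.
apply: (@leq_trans (\sum_(s in S) maxn 1 (d.+1 - #|S|))); last exact: leq_sum.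
rewrite sum_nat_const; case: (leqP d #|S|) => [le_dS|lt_Sd].
  by apply: leq_trans le_dS _; rewrite leq_pmulr // leq_max.
apply: (@leq_trans (#|S| * (d.+1 - #|S|))); last first.
  by rewrite leq_mul2l leq_maxr orbT.
(* The product is [#|S| + #|S| * (d - #|S|)], at least [d] as [#|S|] is positive. *)
have -> : (d.+1 - #|S| = (d - #|S|).+1)%N by rewrite subSn // ltnW.
by rewrite mulnS -leq_subLR leq_pmull.
Qed.

Lemma disconnecting_card_ge (T : finType) (e : rel T) (u : T)
    (F : {set {set T}}) :
    symmetric e -> irreflexive e -> (forall y, y != u -> e u y) ->
  disconnecting e F -> (min_degree e <= #|F|)%N.
Proof.
move=> symE irrE univ /andP[_]; rewrite (n_comp_universal symE univ).
have symF := sym_connect_sym (delete_edges_sym F symE).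
case/(n_comp_gt1P symF)=> x [y nxy].
set S := [set z | ~~ connect (delete_edges e F) u z].
have uS : u \notin S by rewrite inE negbK connect0.
have S0 : S != set0.
  apply: contraNneq nxy => S0.
  have conn_u z : connect (delete_edges e F) u z.
    by move/setP/(_ z): S0; rewrite !inE => /negbFE.
  by apply: (connect_trans _ (conn_u y)); rewrite symF.
apply: leq_trans (boundary_ge symE irrE univ uS S0) _.
set P := [set p | _]; set f := fun p : T * T => [set p.1; p.2].
(* Exactly one end of a boundary edge is in [S], so the edge determines the ordered pair. *)
have injf : {in P &, injective f}.
  move=> [s t] [s' t']; rewrite !inE /= => /and3P[sS tS _] /and3P[s'S t'S _] eqf.
  have: s \in f (s', t') by rewrite -eqf set21.
  have: t \in f (s', t') by rewrite -eqf set22.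
  rewrite !inE => /pred2P[] /= Et; first by rewrite Et s'S in tS.
  by case/pred2P=> /= Es; [rewrite Es Et | rewrite Es (negPf t'S) in sS].
(* A boundary edge outside [F] would connect [s] to [u] through [t]. *)
rewrite -(card_in_imset injf); apply/subset_leq_card/subsetP=> A.
case/imsetP=> -[s t] /[!inE] /= /and3P[]; rewrite negbK => nus ust est ->.
apply: contraR nus => nstF; apply: connect_trans ust _.
by rewrite symF; apply: connect1; rewrite /delete_edges /= est.
Qed.

(** * Stars as minimum disconnecting sets *)

Lemma card_edges_at (T : finType) (e : rel T) (x : T) : irreflexive e ->
  #|edges_between e x [set y | e x y]| = degree e x.
Proof.
move=> irrE; rewrite /degree -(card_in_imset (f := fun y => [set x; y])).
  apply: eq_card => A; rewrite inE; apply/andP/imsetP => [[_]|[y]].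
    by case/exists_inP=> y exy /eqP->; exists y.
  move=> exy ->; split; last by apply/exists_inP; exists y.
  by apply/imsetP; exists (x, y); rewrite // inE; rewrite inE in exy.
move=> y z; rewrite !inE => exy _ eqA.
have: y \in [set x; z] by rewrite -eqA set22.
by rewrite !inE => /pred2P[] // Ey; rewrite Ey irrE in exy.
Qed.

Lemma edges_at_disconnecting (T : finType) (e : rel T) (u x : T) :
    symmetric e -> irreflexive e -> (forall y, y != u -> e u y) ->
  (0 < degree e x)%N -> disconnecting e (edges_between e x [set y | e x y]).
Proof.
move=> symE irrE univ; rewrite card_gt0 => /set0Pn[y /[!inE] exy].
set F := edges_between _ _ _.
have symF := sym_connect_sym (delete_edges_sym F symE).
rewrite /disconnecting (n_comp_universal symE univ); apply/andP; split.
  by apply/subsetP=> A; rewrite inE => /andP[].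
(* A path from [x] to its neighbour [y] would have to start with a deleted edge. *)
apply/(n_comp_gt1P symF); exists x, y.
apply/connectP => -[[|z p] /=]; first by move=> _ Ey; rewrite Ey irrE in exy.
case/andP=> /andP[exz /negP[]]; rewrite inE; apply/andP; split.
  by apply/imsetP; exists (x, z); rewrite ?inE.
by apply/exists_inP; exists z; rewrite ?inE.
Qed.

Lemma edges_at_minimum_disconnecting (T : finType) (e : rel T) (u x : T) :
    symmetric e -> irreflexive e -> (forall y, y != u -> e u y) ->
    (0 < degree e x)%N -> degree e x = min_degree e ->
  minimum_disconnecting e (edges_between e x [set y | e x y]).
Proof.
move=> symE irrE univ dx_gt0 dx; split.
  exact: (edges_at_disconnecting symE irrE univ).
by move=> F; rewrite card_edges_at // dx; apply: (disconnecting_card_ge symE irrE univ).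
Qed.

(** * Adjacency in power graphs via cyclic subgroups *)

Lemma is_pos_powerE (gT : finGroupType) (u v : gT) :
  is_pos_power u v <-> v \in <[u]>.
Proof.
split=> [[m _ ->]|/cycleP[m ->]]; first exact: mem_cycle.
(* [m] may be 0; adding the order of [u] makes the exponent positive and keeps the power. *)
exists (m + #[u])%N; first by rewrite addn_gt0 order_gt0 orbT.
by rewrite expgD expg_order mulg1.
Qed.

Lemma power_graphE (gT : finGroupType) (u v : gT) :
  power_graph gT u v = (u != v) && ((v \in <[u]>) || (u \in <[v]>)).
Proof.
rewrite /power_graph /=; congr (_ && _); apply/asboolP/orP.
  by case=> /is_pos_powerE; [left | right].
by case=> /is_pos_powerE; [left | right].
Qed.

Lemma power_graph1 (gT : finGroupType) (y : gT) : y != 1 -> power_graph gT 1 y.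
Proof. by move=> ny1; rewrite power_graphE eq_sym ny1 group1 orbT. Qed.

Import GRing.Theory.

(** * A permutation model of the dicyclic group *)

Section DicyclicModel.

(* The regular representation of the dicyclic group: (i, e) stands for
   a^i b^e, and the two permutations are right multiplication by a and b. The
   group they generate is a quotient of the presented group, which shows that
   the latter has at least 4n elements. *)
Variable n : nat.
Hypothesis n_gt0 : (0 < n)%N.

Local Notation Z := 'Z_(2 * n).

(** The relation [ab = ba^-1] gives [ba = a^-1 b], so on [a^i b] the exponent [i] goes down. *)
Definition rot_fun (p : Z * bool) : Z * bool :=
  ((if p.2 then p.1 - 1 else p.1 + 1)%R, p.2).

(** The shift by [n] comes from [b^2 = a^n]. *)
Definition flip_fun (p : Z * bool) : Z * bool :=
  ((if p.2 then p.1 + n%:R else p.1)%R, ~~ p.2).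

Lemma rot_inj : injective rot_fun.
Proof. by move=> [i x] [j y] [] /[swap] /= <-{y}; case: x => [/subIr->|/addIr->]. Qed.

Lemma flip_inj : injective flip_fun.
Proof. by move=> [i x] [j y] [] /[swap] /= /negb_inj<-{y}; case: x => [/addIr->|->]. Qed.

Definition rot_perm := perm rot_inj.
Definition flip_perm := perm flip_inj.

Lemma rot_permX k i (e : bool) :
  (rot_perm ^+ k) (i, e) = ((if e then i - k%:R else i + k%:R)%R, e).
Proof.
elim: k i => [|k IHk] i; first by rewrite perm1 subr0 addr0; case: e.
rewrite expgS permM permE IHk /rot_fun /=; case: e {IHk} => /=.
  by rewrite -addrA -opprD -natr1 (addrC 1%R).
by rewrite -addrA -natr1 (addrC 1%R).
Qed.

Lemma double_n : (n%:R + n%:R = 0 :> Z)%R.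
Proof. by rewrite -natrD addnn -mul2n pchar_Zp // (leq_mul2l 2 1). Qed.

Lemma flip_permX2 i (e : bool) : (flip_perm ^+ 2) (i, e) = ((i + n%:R)%R, e).
Proof. by rewrite expgS expg1 permM !permE /flip_fun /=; case: e. Qed.

Lemma rot_flip_relations :
  [/\ rot_perm ^+ (2 * n)%N = 1, rot_perm ^+ n = flip_perm ^+ 2
    & rot_perm * flip_perm = flip_perm * rot_perm^-1].
Proof.
have rotX : rot_perm ^+ n = flip_perm ^+ 2.
  apply/permP=> -[i e]; rewrite rot_permX flip_permX2; case: e => //.
  (* On [a^i b] the exponents [i - n] and [i + n] agree modulo [2n]. *)
  by congr (_, _); apply/eqP; rewrite subr_eq -addrA double_n addr0.
split=> //.
  apply/permP=> -[i e]; rewrite rot_permX perm1 pchar_Zp ?subr0 ?addr0 ?if_same //.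
  by rewrite (leq_mul2l 2 1).
apply: (mulIg rot_perm); rewrite mulgKV; apply/permP=> -[i e].
rewrite !permM !permE /rot_fun /flip_fun /=; case: e => /=; last by rewrite addrK.
by congr (_, _); rewrite addrAC subrK.
Qed.

Lemma card_rot_flip_ge : (4 * n <= #|<<[set rot_perm; flip_perm]>>|)%N.
Proof.
set H := <<_>>.
have -> : (4 * n = #|[set: Z * bool]|)%N.
  rewrite cardsT card_prod card_bool card_ord Zp_cast ?(leq_mul2l 2 1) //.
  exact: (mulnAC 2 2).
(* The orbit of [(0, false)], which stands for the identity, is everything:
   [rot_perm ^+ i * flip_perm ^+ e] sends it to [(i, e)]. *)
apply: leq_trans (leq_imset_card (fun h : {perm Z * bool} => h (0%R, false)) _).
apply/subset_leq_card/subsetP=> -[i e] _.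
apply/imsetP; exists (rot_perm ^+ i * flip_perm ^+ e).
  by rewrite groupM ?groupX ?mem_gen ?set21 ?set22.
rewrite permM rot_permX /= add0r natr_Zp; case: e; last by rewrite perm1.
by rewrite expg1 permE.
Qed.

End DicyclicModel.

(** * Normal forms and order of the dicyclic group *)

Section Dicyclic.

Variables (n : nat) (gT : finGroupType) (a b : gT).
Hypotheses (n_gt0 : (0 < n)%N) (dicyc : dicyclic n a b).

(** The model satisfies the relations, so it is a homomorphic image of [gT]. *)
Lemma dicyclic_card_ge : (4 * n <= #|gT|)%N.
Proof.
have [isoG _ _ _ _] := dicyc.
have [relx relxy relc] := rot_flip_relations n_gt0.
suff homH : <<[set rot_perm n; flip_perm n]>> \homg [set: gT].
  rewrite -cardsT; apply: leq_trans (card_rot_flip_ge n_gt0) _.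
  by have /homgP[f <-] := homH; apply: leq_morphim.
rewrite isoG; apply/existsP; exists (rot_perm n, flip_perm n).
rewrite /= !xpair_eqE.
by rewrite joing_idl joing_idr relx relxy relc !eqxx.
Qed.

Lemma dicyclic_expM i : a ^+ i * b = b * a ^- i.
Proof.
have [_ _ _ _ ab] := dicyc.
elim: i => [|i IHi]; first by rewrite invg1 mulg1 mul1g.
by rewrite expgSr -mulgA ab mulgA IHi -mulgA -expgSr expgS invMg.
Qed.

Lemma dicyclic_b2 i : (a ^+ i * b) ^+ 2 = a ^+ n.
Proof.
have [_ _ _ -> _] := dicyc.
by rewrite expgS expg1 {1}dicyclic_expM mulgA mulgKV.
Qed.

(** [b] normalises [<[a]>], so the group is [<[a]> * <[b]>]; even powers of [b] are powers of
    [a ^+ n] and are absorbed into the first factor. *)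
Lemma dicyclic_elt (x : gT) : exists i, x = a ^+ i \/ x = a ^+ i * b.
Proof.
have [_ genG _ anb2 ab] := dicyc.
have nab : <[b]> \subset 'N(<[a]>).
  rewrite cycle_subG; apply/normP; rewrite -cycleJ.
  have -> : a ^ b = a^-1 by rewrite conjgE ab mulKg.
  exact: cycleV.
have : x \in <[a]> <*> <[b]> by rewrite joing_idl joing_idr [_ <*> _]genG inE.
rewrite norm_joinEr // => /mulsgP[_ _ /cycleP[i ->] /cycleP[j ->] ->].
exists (i + n * j./2)%N.
have -> : b ^+ j = a ^+ (n * j./2) * b ^+ odd j.
  by rewrite -{1}[j]odd_double_half addnC -mul2n expgD !expgM anb2.
by rewrite mulgA -expgD; case: (odd j); [right | left]; rewrite ?mulg1.
Qed.

(** [<[a]>] and its coset by [b] cover a group of at least [4n] elements, while [a] has order at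
    most [2n]. Hence the two cosets are distinct and the bound on the order is attained. *)
Lemma dicyclic_order : #[a] = (2 * n)%N /\ b \notin <[a]>.
Proof.
have [_ _ a2n _ _] := dicyc.
have cover : [set: gT] \subset <[a]> :|: <[a]> :* b.
  apply/subsetP=> x _; have [i [] ->] := dicyclic_elt x.
    by rewrite inE mem_cycle.
  by rewrite inE mem_rcoset mulgK mem_cycle orbT.
have le_a : (#[a] <= 2 * n)%N.
  by apply: dvdn_leq; rewrite ?muln_gt0 // order_dvdn a2n.
have le4 : (4 * n <= #|<[a]> :|: <[a]> :* b|)%N.
  by apply: leq_trans dicyclic_card_ge _; rewrite -cardsT subset_leq_card.
have ab : b \notin <[a]>.
  apply: contraL le4 => /rcoset_id->; rewrite setUid -ltnNge.
  apply: leq_ltn_trans le_a _.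
  by rewrite -[(4 * n)%N]/((2 + 2) * n)%N mulnDl -[ltnLHS]addn0 ltn_add2l muln_gt0.
split=> //; apply/eqP; rewrite eqn_leq le_a.
have := leq_trans le4 (leq_card_setU _ _).1.
by rewrite card_rcoset -orderE addnn -mul2n -[4%N]/(2 * 2)%N -mulnA leq_pmul2l.
Qed.

Lemma dicyclic_reflectionN i : a ^+ i * b \notin <[a]>.
Proof. by rewrite groupMl ?mem_cycle //; have [] := dicyclic_order. Qed.

Lemma dicyclic_reflection_neq i j : (a ^+ i * b == a ^+ j) = false.
Proof.
by apply: contraNF (dicyclic_reflectionN i) => /eqP->; apply: mem_cycle.
Qed.

Lemma dicyclic_an_involution (x : gT) : a ^+ n * (a ^+ n * x) = x.
Proof.
have [_ _ a2n _ _] := dicyc.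
by rewrite mulgA -expgD addnn -mul2n a2n mul1g.
Qed.

Lemma dicyclic_an_neq1 : (a ^+ n == 1) = false.
Proof.
have [oa _] := dicyclic_order.
by rewrite -order_dvdn oa gtnNdvd // -[ltnLHS]mul1n ltn_pmul2r.
Qed.

Lemma dicyclic_anX_in k : a ^+ (n * k) \in [set 1; a ^+ n].
Proof.
elim: k => [|k]; first by rewrite muln0 set21.
rewrite mulnS expgD !inE => /pred2P[] ->; first by rewrite mulg1 eqxx orbT.
by rewrite -[a ^+ n in X in _ * X]mulg1 dicyclic_an_involution eqxx.
Qed.

(** * Neighbourhoods and degrees in the dicyclic power graph *)

(** For [y = a ^+ i * b], the square [a ^+ n] is an involution, so the powers of [y] are [1], [y],
    [y ^+ 2] and [y ^+ 3 = a ^+ n * y]. *)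
Lemma cycle_reflection i v :
  (v \in <[a ^+ i * b]>)
    = (v \in [set 1; a ^+ n; a ^+ i * b; a ^+ (n + i) * b]).
Proof.
rewrite expgD -mulgA; set y := a ^+ i * b.
have y2 : y ^+ 2 = a ^+ n := dicyclic_b2 i.
apply/idP/idP => [/cycleP[k ->]|].
  rewrite -[k]odd_double_half addnC -mul2n expgD expgM y2 -expgM !inE.
  have := dicyclic_anX_in k./2; rewrite !inE => /pred2P[] ->.
    by case: (odd k); rewrite mul1g eqxx ?orbT.
  by case: (odd k); rewrite ?mulg1 eqxx ?orbT.
rewrite !inE -!orbA => /or4P[] /eqP->; rewrite -?y2 ?group1 //.
- exact: mem_cycle.
- exact: cycle_id.
by rewrite -expgSr mem_cycle.
Qed.

(** Only powers of [a ^+ i * b] matter: it is not a power of any [a ^+ j], and if it is a power of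
    [a ^+ j * b], then the two are equal or differ by the factor [a ^+ n], so the latter is already
    in [<[a ^+ i * b]>]. *)
Lemma reflection_neighbours i :
  [set v | power_graph gT (a ^+ i * b) v] = [set 1; a ^+ n; a ^+ (n + i) * b].
Proof.
apply/setP=> v; rewrite inE power_graphE cycle_reflection !inE.
have neqX := dicyclic_reflection_neq; have neq1 k := neqX k 0.
have [j [] ->] := dicyclic_elt v.
  have /negPf-> : a ^+ i * b \notin <[a ^+ j]>.
    apply: contra (dicyclic_reflectionN i); apply/subsetP.
    by rewrite cycle_subG mem_cycle.
  by rewrite neqX -[a ^+ j == _ * b]eq_sym neqX !orbF.
rewrite cycle_reflection !inE !neqX !neq1 /= !expgD -!mulgA.
set x := a ^+ i * b; set y := a ^+ j * b.
have -> : (x == a ^+ n * y) = (y == a ^+ n * x).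
  by rewrite -(inj_eq (mulgI (a ^+ n))) dicyclic_an_involution eq_sym.
rewrite [y == x]eq_sym; case: eqVneq => [<-|_] /=; last by rewrite orbb.
by rewrite -{1}[x]mul1g (inj_eq (mulIg x)) eq_sym dicyclic_an_neq1.
Qed.

Lemma degree_reflection i : degree (power_graph gT) (a ^+ i * b) = 3.
Proof.
rewrite /degree reflection_neighbours -setUA cardsU1 cards2 !inE.
rewrite ![_ == _ * b]eq_sym (dicyclic_reflection_neq _ 0) dicyclic_reflection_neq.
by rewrite eq_sym dicyclic_an_neq1.
Qed.

(** The identity and the generators [a], [a^-1] are adjacent to all other elements of [<[a]>], of
    which there are at least 3. Any other power of [a] is adjacent to [1], [a] and [a^-1], distinct
    because [a] has order at least 4. *)
Lemma degree_rotation_ge i :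
  (1 < n)%N -> (3 <= degree (power_graph gT) (a ^+ i))%N.
Proof.
move=> n_gt1; have [oa _] := dicyclic_order.
have o_ge4 : (4 <= #[a])%N by rewrite oa (leq_mul2l 2 2).
have x_in : a ^+ i \in <[a]> := mem_cycle a i.
have [x_end|] := boolP (a ^+ i \in [set 1; a; a^-1]).
  apply: (@leq_trans #|<[a]> :\ a ^+ i|).
    by move: o_ge4; rewrite orderE (cardsD1 (a ^+ i)) x_in.
  apply/subset_leq_card/subsetP=> y; rewrite !inE power_graphE eq_sym.
  case/andP=> -> ya /=; move: x_end; rewrite !inE -orbA => /or3P[] /eqP->.
  - by rewrite group1 orbT.
  - by rewrite ya.
  by rewrite cycleV ya.
rewrite !inE !negb_or -andbA => /and3P[x1 xa xV].
have a1 : a != 1 by rewrite -order_gt1; apply: leq_trans o_ge4.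
have aV : a != a^-1.
  apply: contraTneq o_ge4 => aV; rewrite -ltnNge ltnS.
  apply: (@leq_trans 2) => //; apply: dvdn_leq => //.
  by rewrite order_dvdn expgS expg1 {1}aV mulVg.
have <- : #|[set 1; a; a^-1]| = 3.
  by rewrite -setUA cardsU1 cards2 !inE eq_sym negb_or a1 aV eq_sym invg_eq1 a1.
apply/subset_leq_card/subsetP=> y; rewrite !inE power_graphE -orbA.
by case/or3P=> /eqP->; rewrite ?x1 ?xa ?xV ?group1 ?cycleV ?x_in ?orbT.
Qed.

End Dicyclic.

Theorem theorem5p4 (n : nat) (gT : finGroupType) (a b : gT)
    (hn : (2 <= n)%N) (hQ : dicyclic n a b) :
  min_degree (power_graph gT) = 3 /\
  forall i : nat, (0 <= i <= n - 1)%N ->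
    minimum_disconnecting (power_graph gT)
      (edges_between (power_graph gT) (a ^+ i * b)
         [set 1; a ^+ n; a ^+ (n + i)%N * b]) /\
    minimum_disconnecting (power_graph gT)
      (edges_between (power_graph gT) (a ^+ (n + i)%N * b)
         [set 1; a ^+ n; a ^+ i * b]).
Proof.
have n_gt0 : (0 < n)%N by apply: leq_trans hn.
have min3 : min_degree (power_graph gT) = 3.
  apply/eqP; rewrite eqn_leq -{1}(degree_reflection n_gt0 hQ 0) min_degree_le.
  apply: (min_degree_ge 1) => x.
  have [j [] ->] := dicyclic_elt hQ x; last by rewrite (degree_reflection n_gt0 hQ).
  exact: (degree_rotation_ge n_gt0 hQ).
split=> // i _.
have star j : minimum_disconnecting (power_graph gT)
    (edges_between (power_graph gT) (a ^+ j * b)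
       [set 1; a ^+ n; a ^+ (n + j) * b]).
  rewrite -(reflection_neighbours n_gt0 hQ).
  apply: (@edges_at_minimum_disconnecting _ _ 1); rewrite ?(degree_reflection n_gt0 hQ) //.
  - exact: power_graph_sym.
  - exact: power_graph_irr.
  exact: power_graph1.
(* The second star is the first one at index [n + i], since [a ^+ (n + (n + i)) = a ^+ i]. *)
split=> //; have := star (n + i)%N.
by rewrite !expgD -!mulgA (dicyclic_an_involution hQ).
Qed.
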